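(* Let $n\ge 0$ and $N\ge 1$ be integers and write $\mathbf G_n(N)=x+yi$ with $x,y\in\mathbb Z$. Then: $n\equiv 0\pmod 4$ implies $y=0$; $n\equiv 2\pmod 4$ implies $x=0$; $n\equiv 1\pmod 4$ implies $x=y$; $n\equiv 3\pmod 4$ implies $x=-y$.
   Context: Here $i^2=-1$ and $\mathbf G_n(N)=\sum_{a=1}^{N-1}\sum_{b=1}^{N-1}(a+bi)^n\in\mathbb Z[i]$ (an empty sum, equal to $0$, when $N=1$). *)

(* Defs.v *)
From HB Require Import structures.
From mathcomp Require Import all_boot all_order all_algebra.
From mathcomp Require Import complex.

Set Implicit Arguments.
Unset Strict Implicit.
Unset Printing Implicit Defensive.

Import GRing.Theory.
Local Open Scope ring_scope.
Local Open Scope complex_scope.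

(* The library gives [R[i]] a zmodType structure and a complex product over any
   commutative ring, but a ring structure only over fields; hence the alias for
   Z[i], which carries the missing ring structure. *)
Definition gaussInt : Type := int[i].

HB.instance Definition _ := GRing.Zmodule.on gaussInt.

Definition gaussInt1 : gaussInt := 1 +i* 0.

Lemma gaussInt_mul1 : left_id gaussInt1 (@ComplexField.mulc int).
Proof. by case=> a b /=; rewrite !mul1r !mul0r subr0 addr0. Qed.

Lemma gaussInt_mulDl :
  left_distributive (@ComplexField.mulc int) (@ComplexField.addc int).
Proof.
case=> [a b] [c d] [e f] /=; rewrite !mulrDl !opprD -!addrA.
by congr ((_ + _) +i* (_ + _)); rewrite addrCA.
Qed.

Lemma gaussInt_oner_neq0 : gaussInt1 != 0.
Proof. by []. Qed.

HB.instance Definition _ := GRing.Zmodule_isComNzRing.Build gaussInt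
  (@ComplexField.mulcA int) (@ComplexField.mulcC int)
  gaussInt_mul1 gaussInt_mulDl gaussInt_oner_neq0.

Definition gaussSum (n N : nat) : gaussInt :=
  \sum_(1 <= a < N) \sum_(1 <= b < N) (a%:Z +i* b%:Z : gaussInt) ^+ n.

(* Main.v *)
Require Import Defs.
From mathcomp Require Import all_boot all_order all_algebra.
From mathcomp Require Import complex.
From HB Require Import structures.
From mathcomp Require Import zify.

(** Reflecting the square of summation in its diagonal exchanges [a] and [b],
    so it leaves the sum [G] unchanged.  On Gaussian integers this reflection
    is [z |-> i * conj z], hence it turns [z ^+ n] into [i ^+ n * conj (z ^+ n)];
    as conjugation is a ring morphism, summing over the square gives
    [G = i ^+ n * conj G] ([gaussSum_reflection]).  Since [i ^+ 4 = 1], this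
    puts [G = x + y i] on one of the four axes of symmetry [y = 0], [x = y],
    [x = 0], [x = - y] of the grid Z[i], according to [n] modulo 4. *)

Import GRing.Theory.
Local Open Scope ring_scope.
Local Open Scope complex_scope.

Definition gaussI : gaussInt := 0 +i* 1.

Definition gaussConj (z : gaussInt) : gaussInt :=
  let: u +i* v := z in u +i* - v.

Lemma gaussConj_is_zmod_morphism : zmod_morphism gaussConj.
Proof. by case=> [a b] [c d]; congr (_ +i* _); lia. Qed.

Lemma gaussConj_is_monoid_morphism : monoid_morphism gaussConj.
Proof. by split=> // -[a b] [c d]; congr (_ +i* _); lia. Qed.

HB.instance Definition _ := GRing.isZmodMorphism.Build gaussInt gaussInt
  gaussConj gaussConj_is_zmod_morphism.
HB.instance Definition _ := GRing.isMonoidMorphism.Build gaussInt gaussInt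
  gaussConj gaussConj_is_monoid_morphism.

Lemma gaussI_mul_conj (u v : int) :
  gaussI * gaussConj (u +i* v) = v +i* u.
Proof. by congr (_ +i* _); lia. Qed.

Lemma gaussI_exp4 : gaussI ^+ 4 = 1.
Proof. by []. Qed.

(** Exchanging the two summations replaces each [z] by its mirror image
    [gaussI * gaussConj z]. *)
Lemma gaussSum_reflection (n N : nat) :
  gaussSum n N = gaussI ^+ n * gaussConj (gaussSum n N).
Proof.
rewrite {1}/gaussSum exchange_big /= /gaussSum rmorph_sum mulr_sumr.
apply: eq_bigr => b _; rewrite rmorph_sum mulr_sumr.
apply: eq_bigr => a _.
by rewrite rmorphXn -exprMn gaussI_mul_conj.
Qed.

Theorem corollary1 (n N : nat) (x y : int) (N_ge1 : (1 <= N)%N)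
    (GE : gaussSum n N = x +i* y) :
  [/\ n = 0 %[mod 4] -> y = 0,
      n = 2 %[mod 4] -> x = 0,
      n = 1 %[mod 4] -> x = y
    & n = 3 %[mod 4] -> x = - y].
Proof.
have := gaussSum_reflection n N; rewrite GE -(expr_mod n gaussI_exp4) => refl.
by split=> nE; move: refl; rewrite nE => -[]; lia.
Qed.
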